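(* For every positive integer $n$ and every $S\subseteq[n-1]$, \[ d(S,n)=\sum_{I\subseteq \mathrm{Spike}(S)} p(I,n). \]
   Context: $\mathfrak{S}_n$ is the set of permutations $\sigma=\sigma_1\cdots\sigma_n$ of $[n]=\{1,\ldots,n\}$. $\mathrm{Des}(\sigma)=\{i\in[n-1]:\sigma_i>\sigma_{i+1}\}$; $d(S,n)$ is the number of $\sigma\in\mathfrak{S}_n$ with $\mathrm{Des}(\sigma)=S$. For $S\subseteq[n-1]$: $\mathrm{Peak}(S)=\{i:1<i\le n-1,\ i\in S,\ i-1\notin S\}$, $\mathrm{Valley}(S)=\{i:1<i\le n-1,\ i\notin S,\ i-1\in S\}$, $\mathrm{Spike}(S)=\mathrm{Peak}(S)\cup\mathrm{Valley}(S)$. For $\sigma\in\mathfrak{S}_n$, $\mathrm{Peak}(\sigma)=\mathrm{Peak}(\mathrm{Des}(\sigma))$. For a set $I$, $P(I,n)$ is the set of $\sigma\in\mathfrak{S}_n$ with $\mathrm{Peak}(\sigma)=I$, and $p(I,n)=2^{-n+|I|+1}|P(I,n)|$. *)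

(* Defs.v *)
From mathcomp Require Import all_boot all_order all_fingroup all_algebra.

Set Implicit Arguments.
Unset Strict Implicit.
Unset Printing Implicit Defensive.

Import GRing.Theory Num.Theory.

(* A position i in [n-1] = {1, ..., n-1} is the ordinal i : 'I_n of the same
   value, so a subset of [n-1] is a set S : {set 'I_n} with S \subset [n-1];
   the ordinal 0 is never a position.  For i > 0, ord_pred i has value i - 1. *)
Definition positions (n : nat) : {set 'I_n} := [set i : 'I_n | 0 < i].

(* The arguments and values of s : 'S_n are shifted down by one with respect to
   [n]: the letter sigma_k is s at the ordinal k - 1, plus one.  Hence
   sigma_i > sigma_(i+1) reads s (ord_pred i) > s i. *)
Definition Des (n : nat) (s : 'S_n) : {set 'I_n} :=
  [set i in positions n | s (ord_pred i) > s i].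

Definition d (n : nat) (S : {set 'I_n}) : nat :=
  #|[set s : 'S_n | Des s == S]|.

Definition Peak (n : nat) (S : {set 'I_n}) : {set 'I_n} :=
  [set i : 'I_n | [&& 1 < i, i \in S & ord_pred i \notin S]].

Definition Valley (n : nat) (S : {set 'I_n}) : {set 'I_n} :=
  [set i : 'I_n | [&& 1 < i, i \notin S & ord_pred i \in S]].

Definition Spike (n : nat) (S : {set 'I_n}) : {set 'I_n} :=
  Peak S :|: Valley S.

Definition peak_perms (n : nat) (I : {set 'I_n}) : {set 'S_n} :=
  [set s : 'S_n | Peak (Des s) == I].

(* The exponent is an integer, negative in general. *)
Definition p (n : nat) (I : {set 'I_n}) : rat :=
  ((2%:R : rat) ^ (- n%:Z + #|I|%:Z + 1) * #|peak_perms I|%:R)%R.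

(* Main.v *)
Require Import Defs.
From mathcomp Require Import all_boot all_order all_fingroup all_algebra.
From mathcomp Require Import zify.

Set Implicit Arguments.
Unset Strict Implicit.
Unset Printing Implicit Defensive.

Import GRing.Theory Num.Theory.

(** For a set [B] of letters, let [pi_B] move the letters of [B] below the
    others and reverse their order.  Whether [pi_B] inverts two letters then
    depends only on whether the larger one lies in [B].  Since [w |-> pi_B w]
    is a bijection of the symmetric group, [2 ^ n * d(S, n)] counts the pairs
    [(B, w)] such that [pi_B w] has descent set [S].  Given [w], each position
    [i] prescribes whether the larger of [w_i, w_(i+1)] lies in [B]: a peak of
    [w] receives two prescriptions, compatible exactly when the peak lies in
    [Spike S]; an interior or boundary valley receives none; every other letter
    receives one.  There is one more valley than there are peaks, so the number
    of admissible [B] is [2 ^ (|Peak w| + 1)] if [Peak w] is contained in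
    [Spike S], and [0] otherwise. *)

(** Each letter goes to its rank, the number of letters with a smaller key. *)
Lemma exists_rank_perm n (k : 'I_n -> nat) :
  injective k -> exists pi : 'S_n, forall x y, (pi x < pi y) = (k x < k y).
Proof.
move=> k_inj; pose below x := [set z | k z < k x].
have ltr x : #|below x| < n.
  rewrite -[X in _ < X]card_ord -cardsT; apply: proper_card.
  by apply/properP; split; [apply: subsetT | exists x; rewrite ?inE ?ltnn].
have rank_lt x y : k x < k y -> #|below x| < #|below y|.
  move=> lt_xy; apply/proper_card/properP; split.
    by apply/subsetP => z; rewrite !inE => /ltn_trans; apply.
  by exists x; rewrite !inE ?ltnn.
have rank_inj : injective (fun x => Ordinal (ltr x)).
  move=> x y /(congr1 val) /= eq_xy; apply: k_inj.
  by case: (ltngtP (k x) (k y)) => // /rank_lt; rewrite eq_xy ltnn.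
exists (perm rank_inj) => x y; rewrite !permE /=.
case: (ltngtP (k x) (k y)) => [/rank_lt // | /rank_lt | /k_inj ->].
  by move=> lt_yx; apply/negbTE; rewrite -leqNgt ltnW.
by rewrite ltnn.
Qed.

Lemma exists_flip_perm n (B : {set 'I_n}) :
  exists pi : 'S_n, forall x y : 'I_n, x < y -> (pi y < pi x) = (y \in B).
Proof.
(* Keys of [B] fall in [[1, n]] in reverse order, the others in [[n, 2n - 1]]; only the letter [0]
   can have key [n]. *)
pose k (x : 'I_n) : nat := if x \in B then n - x else n + x.
have k_lt (x y : 'I_n) : x < y -> (k y < k x) = (y \in B).
  rewrite /k => lt_xy; have := ltn_ord y.
  by case: (x \in B); case: (y \in B) => lt_yn; lia.
have k_inj : injective k.
  move=> x y; rewrite /k => eq_k; apply: val_inj => /=; move: eq_k.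
  have := ltn_ord x; have := ltn_ord y.
  by case: (x \in B); case: (y \in B); lia.
have [pi pi_lt] := exists_rank_perm k_inj.
by exists pi => x y /k_lt <-.
Qed.

Lemma val_ord_pred n (i : 'I_n) : 0 < i -> ord_pred i = i.-1 :> nat.
Proof.
move=> i_gt0 /=; have lt_in := ltn_ord i.
have -> : (i + n).-1 = i.-1 + n by lia.
by rewrite modnDr modn_small //; lia.
Qed.

Lemma val_ordS n (j : 'I_n) : ordS j = (if j.+1 < n then j.+1 else 0) :> nat.
Proof.
have lt_jn := ltn_ord j; rewrite /=; case: ltnP => [/modn_small // | le_nj].
have eq_n : j.+1 = n by lia.
by rewrite -[X in _ %% X]eq_n modnn.
Qed.

Lemma Des_sub_positions n (s : 'S_n) : Des s \subset positions n.
Proof. by apply/subsetP => i; rewrite inE => /andP[]. Qed.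

(* The flip by the values [w @: C] turns [w] into a permutation with descent
   set [S] exactly when the set [C] of flipped places satisfies this. *)
Definition flips_to n (S D C : {set 'I_n}) : bool :=
  [forall i in positions n,
     (if i \in D then ord_pred i \notin C else i \in C) == (i \in S)].

Lemma d_flip n (S B : {set 'I_n}) : S \subset positions n ->
  d S = #|[set w : 'S_n | flips_to S (Des w) (w @^-1: B)]|.
Proof.
move=> /subsetP sub_S; have [pi pi_lt] := exists_flip_perm B.
rewrite /d -[LHS](card_preimset _ (mulIg pi)).
apply: eq_card => w; rewrite !inE.
have Des_pi i : i \in positions n ->
    (i \in Des (w * pi)%g) =
    (if i \in Des w then ord_pred i \notin w @^-1: B else i \in w @^-1: B).
  rewrite inE => i_gt0; rewrite !inE i_gt0 /= !permM.
  (* The larger letter sits at [ord_pred i] if [w] descends there, at [i] otherwise; equality would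
     force [ord_pred i = i]. *)
  case: (ltngtP (w i)) => [lt_w | lt_w | /val_inj/perm_inj eq_i].
  - rewrite -(pi_lt _ _ lt_w) -leqNgt ltn_neqAle.
    rewrite (inj_eq val_inj) (inj_eq perm_inj).
    by rewrite andb_idl // => _; apply: contraTneq lt_w => ->; rewrite ltnn.
  - by rewrite pi_lt.
  - have := val_ord_pred i_gt0.
    by rewrite -eq_i; lia.
apply/eqP/forall_inP => [<- i i_pos | eq_S]; first by rewrite Des_pi.
apply/setP => i; have [i_pos | i_npos] := boolP (i \in positions n).
  by rewrite Des_pi //; apply/eqP/eq_S.
rewrite (contraNF (subsetP (Des_sub_positions _) i) i_npos).
by rewrite (contraNF (sub_S i) i_npos).
Qed.

(** Expanding the product picks a boolean at each [x], that is, a set [C], whose term is 1 or 0. *)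
Lemma card_prescribed (T : finType) (ok : T -> bool -> bool) :
  #|[set C : {set T} | [forall x, ok x (x \in C)]]| =
  \prod_x (ok x true + ok x false).
Proof.
rewrite bigA_distr -sum1dep_card big_mkcond; apply: eq_bigr => C _.
case: forallP => [ok_C | /forallP].
  by rewrite big1 // => x _; have := ok_C x; case: ifP => _ ->.
rewrite negb_forall => /existsP[x nok].
by rewrite (bigD1 x) //=; case: ifP nok => _ /negbTE ->.
Qed.

Section FlipCount.

Variables (n : nat) (S D : {set 'I_n}).
Hypotheses (n_gt0 : 0 < n) (sub_D : D \subset positions n).

(* The prescriptions on letter [j] coming from the positions on its left and
   on its right.  For the last letter [ordS j] is [0], which is not in [D]. *)
Let left (j : 'I_n) := (0 < j) && (j \notin D).
Let right (j : 'I_n) := ordS j \in D.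
Let ok (j : 'I_n) (b : bool) :=
  (left j ==> (b == (j \in S))) && (right j ==> (b == (ordS j \notin S))).

Lemma flips_toE C : flips_to S D C = [forall j, ok j (j \in C)].
Proof.
apply/forall_inP/forallP => [flipC j | okC i i_pos].
  apply/andP; split; apply/implyP.
    case/andP=> j_gt0 jD; have := flipC j; rewrite inE j_gt0 (negbTE jD).
    by apply.
  rewrite /right => jD; have := flipC _ (subsetP sub_D _ jD); rewrite jD ordSK.
  by case: (j \in C); case: (ordS j \in S).
case: ifP => iD.
  have /andP[_] := okC (ord_pred i); rewrite /right ord_predK iD /=.
  by case: (_ \in C); case: (i \in S).
have /andP[+ _] := okC i; rewrite /left iD /=.
by move: i_pos; rewrite inE => ->.
Qed.

(** A peak position is the gap just right of the peak letter, hence the shift by [ordS]. *)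
Lemma mem_Peak_ordS j : (ordS j \in Peak D) = left j && right j.
Proof.
rewrite inE ordSK /left /right val_ordS.
have [jD | /negbTE] := boolP (ordS j \in D); last by rewrite !andbF.
have := subsetP sub_D _ jD; rewrite inE val_ordS.
by case: ifP => // _ _; rewrite andbT.
Qed.

Lemma mem_Spike_ordS j : left j -> right j ->
  (ordS j \in Spike S) = ((j \in S) == (ordS j \notin S)).
Proof.
move=> lj rj; have : ordS j \in Peak D by rewrite mem_Peak_ordS lj.
rewrite !inE ordSK => /and3P[-> _ _] /=.
by case: (j \in S); case: (ordS j \in S).
Qed.

Lemma sum_valleys : \sum_j (~~ left j && ~~ right j : nat) = #|Peak D|.+1.
Proof.
have sum_mem (A : {set 'I_n}) : \sum_j (ordS j \in A : nat) = #|A|.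
  pose F i : nat := i \in A.
  rewrite -(reindex_inj (P := predT) (F := F) (@ordS_inj n)) /F.
  by rewrite -sum1_card [RHS]big_mkcond; apply: eq_bigr => i _; case: (i \in A).
have sum_pos : \sum_(j < n) (0 < j : nat) = n.-1.
  case: (n) n_gt0 => // m _.
  by rewrite big_ord_recl /= add0n sum_nat_const card_ord muln1.
have sum_left : \sum_j (left j : nat) + #|D| = n.-1.
  rewrite -sum_pos -sum1_card [X in _ + X]big_mkcond -big_split.
  apply: eq_bigr => j _ /=.
  rewrite /left; have [jD | _] := boolP (j \in D); last by rewrite andbT addn0.
  by have := subsetP sub_D _ jD; rewrite inE => ->.
(* Inclusion-exclusion at each letter; in total [left] holds [n - 1 - #|D|] times and [right] holds
   [#|D|] times. *)
have : \sum_j (left j + right j) + \sum_j (~~ left j && ~~ right j : nat) =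
       \sum_(j < n) 1 + \sum_j (ordS j \in Peak D : nat).
  rewrite -!big_split; apply: eq_bigr => j _ /=; rewrite mem_Peak_ordS.
  by case: (left j); case: (right j).
rewrite big_split sum_mem sum1_card card_ord /= sum_mem sum_left.
by move: n_gt0; lia.
Qed.

(** A letter contributes a factor 2 if free, 1 if its prescriptions agree, 0 if they clash, which
    can happen only at a peak. *)
Lemma card_flips_to :
  #|[set C | flips_to S D C]| =
  (if Peak D \subset Spike S then 2 ^ #|Peak D|.+1 else 0).
Proof.
have -> : [set C | flips_to S D C] =
          [set C : {set 'I_n} | [forall j, ok j (j \in C)]].
  by apply/setP => C; rewrite !inE flips_toE.
rewrite card_prescribed.
case: ifPn => [/subsetP sub_P | /subsetPn[i iP iS]]; last first.
  have := iP; rewrite -(ord_predK i) mem_Peak_ordS => /andP[li ri].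
  have := mem_Spike_ordS li ri; rewrite ord_predK (negbTE iS) => /esym neq.
  rewrite (bigD1 (ord_pred i)) //= /ok li ri /= ord_predK.
  by move: neq; case: (_ \in S); case: (i \in S).
rewrite -sum_valleys expn_sum; apply: eq_bigr => j _; rewrite /ok.
have [lj | _] := boolP (left j); have [rj | _] := boolP (right j) => //=.
- have := mem_Spike_ordS lj rj; rewrite sub_P ?mem_Peak_ordS ?lj // => /esym.
  by case: (_ \in S); case: (_ \in S).
- by case: (_ \in S).
- by case: (_ \in S).
Qed.

End FlipCount.

Lemma sum_Peak n (S : {set 'I_n}) : 0 < n -> S \subset positions n ->
  2 ^ n * d S =
  \sum_(w : 'S_n | Peak (Des w) \subset Spike S) 2 ^ #|Peak (Des w)|.+1.
Proof.
move=> n_gt0 sub_S.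
transitivity (\sum_(B : {set 'I_n})
    \sum_(w : 'S_n) (flips_to S (Des w) (w @^-1: B) : nat)).
  rewrite -{1}(card_ord n) -cardsT -card_powerset powersetT cardsT.
  rewrite -sum_nat_const; apply: eq_bigr => B _.
  rewrite (d_flip B sub_S) -sum1dep_card big_mkcond.
  by apply: eq_bigr => w _; case: flips_to.
rewrite exchange_big [RHS]big_mkcond; apply: eq_bigr => w _.
rewrite -(card_flips_to S n_gt0 (Des_sub_positions w)).
(* For fixed [w], taking preimages permutes the subsets, so counting [B] amounts to counting [C]. *)
have preim_inj : injective (fun B : {set 'I_n} => w @^-1: B).
  move=> B1 B2 /setP eqB; apply/setP => x.
  by have := eqB ((w^-1)%g x); rewrite !inE permKV.
rewrite -(card_preimset _ preim_inj) -sum1_card [RHS]big_mkcond.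
by apply: eq_bigr => B _; rewrite !inE; case: flips_to.
Qed.

Theorem mainTheorem2 (n : nat) (hn : 0 < n) (S : {set 'I_n})
    (hS : S \subset positions n) :
  ((d S)%:R = \sum_(I : {set 'I_n} | I \subset Spike S) p I :> rat)%R.
Proof.
have two_n0 : ((2%:R : rat) ^+ n != 0)%R by rewrite expf_neq0.
(* Clearing [2 ^ n] leaves the natural exponent [#|I| + 1]. *)
apply: (mulfI two_n0).
rewrite -natrX -natrM sum_Peak // natr_sum mulr_sumr.
rewrite (partition_big (fun w : 'S_n => Peak (Des w))
           (fun I => I \subset Spike S)) //=.
apply: eq_bigr => I sub_I; rewrite /p mulrA.
have -> : ((2 ^ n)%:R * (2%:R : rat) ^ (- n%:Z + #|I|%:Z + 1) =
           (2 ^ #|I|.+1)%:R)%R.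
  by rewrite !natrX !exprnP -expfzDr //; congr (_ ^ _)%R; lia.
rewrite mulr_natr -sumr_const [RHS]big_mkcond [LHS]big_mkcond.
apply: eq_bigr => w _; rewrite !inE.
by case: eqP => [-> | _]; rewrite ?sub_I ?andbF.
Qed.
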